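(* Let $K$ be a field. The problem of classifying, up to polynomial similarity, pairs $(A,B)$ of commuting nilpotent square matrices over $K$ (of the same size) satisfying $A^2=0$, $B^3=0$, $AB^2=0$ is wild. Explicitly: let $F_2=K\langle X,Y\rangle$ be the free associative algebra on two free generators $X,Y$ over $K$. Then there exists a pair $P_0=P_0(X,Y)=(A_0(X,Y),B_0(X,Y))$ of commuting nilpotent square matrices of the same size over $F_2$ with $A_0^2=0$, $B_0^3=0$, $A_0B_0^2=0$, such that for any two pairs $(M_1,N_1),(M_2,N_2)\in\mathcal{M}(K)$, if the pairs $P_0(M_1,N_1)$ and $P_0(M_2,N_2)$ are polynomially similar, then the pairs $(M_1,N_1)$ and $(M_2,N_2)$ are similar.
   Context: For an associative ring $R$ with identity, $\mathcal{M}(R)$ denotes the set of all pairs of square matrices over $R$ of the same size, and $\mathcal{N}(R)\subset\mathcal{M}(R)$ denotes the subset of all pairs of commuting nilpotent matrices. Similarity: pairs $(A_1,B_1),(A_2,B_2)\in\mathcal{M}(K)$ are similar if $A_2=S^{-1}A_1S$ and $B_2=S^{-1}B_1S$ for some invertible matrix $S$ over $K$. Polynomial equivalence: a pair $(A,B)\in\mathcal{N}(K)$ is polynomially equivalent to a pair $(\overline{A},\overline{B})\in\mathcal{N}(K)$ if $\overline{A}=f(A,B)$ and $\overline{B}=g(A,B)$ for some polynomials $f,g\in K[x,y]$ with $f(0,0)=g(0,0)=0$ and $$\det\begin{pmatrix}\frac{\partial f}{\partial x}(0,0)&\frac{\partial f}{\partial y}(0,0)\\ \frac{\partial g}{\partial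 x}(0,0)&\frac{\partial g}{\partial y}(0,0)\end{pmatrix}\neq 0.$$ Polynomial similarity: pairs $P,\widetilde{P}\in\mathcal{N}(K)$ are polynomially similar if there is a pair $\overline{P}\in\mathcal{N}(K)$ such that $P$ and $\overline{P}$ are polynomially equivalent and $\overline{P}$ and $\widetilde{P}$ are similar. Substitution: for a pair $P_0(X,Y)$ of $m\times m$ matrices over $F_2$ and a pair $(M,N)\in\mathcal{M}(K)$ of $n\times n$ matrices, $P_0(M,N)$ is the pair of $mn\times mn$ matrices over $K$ obtained by replacing each entry $p(X,Y)\in F_2$ by the $n\times n$ block $p(M,N)$ (scalars $c\in K$ being replaced by $cI_n$). Wildness: the classification problem is wild if there exists a pair $P_0(X,Y)\in\mathcal{N}(F_2)$ satisfying the imposed equations such that, for all $(M_1,N_1),(M_2,N_2)\in\mathcal{M}(K)$, polynomial similarity of $P_0(M_1,N_1)$ and $P_0(M_2,N_2)$ implies similarity of $(M_1,N_1)$ and $(M_2,N_2)$. *)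

(* Defs.v *)
From mathcomp Require Import all_boot all_order all_algebra.
From mathcomp Require Import finmap.
(* The notations of monalg would override those of mpoly, {mpoly _[_]} among
   them. *)
From mathcomp.multinomials Require Import -(notations) monalg.
From mathcomp.multinomials Require Import mpoly.

Set Implicit Arguments.
Unset Strict Implicit.
Unset Printing Implicit Defensive.

Import GRing.Theory.
Local Open Scope ring_scope.

(* Elements of M(R). The common size is part of the data, so that pairs of
   different sizes can be compared; size 0 is allowed. *)
Record mxpair (R : Type) := MxPair {
  mxsize : nat;
  mx1 : 'M[R]_mxsize;
  mx2 : 'M[R]_mxsize }.

Definition nilpotent_mx (R : nzRingType) (n : nat) (A : 'M[R]_n) : Prop :=
  exists k : nat, A ^+ k = 0.

(* Membership in N(R). *)
Definition comm_nilp_pair (R : nzRingType) (P : mxpair R) : Prop :=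
  [/\ comm_mx (mx1 P) (mx2 P), nilpotent_mx (mx1 P) & nilpotent_mx (mx2 P)].

Definition mxpair_similar (K : fieldType) (P Q : mxpair K) : Prop :=
  exists (n : nat) (A B S : 'M[K]_n),
    [/\ S \in unitmx, P = MxPair A B
      & Q = MxPair (invmx S *m A *m S) (invmx S *m B *m S)].

(* f(A, B), where x and y are the variables of index 0 and 1. The library
   morphism mmap does not apply: it needs a nonzero target ring, and 'M_n is
   one only for n of the form n'.+1. *)
Definition mpoly_mxeval (K : fieldType) (f : {mpoly K[2]}) (n : nat)
    (A B : 'M[K]_n) : 'M[K]_n :=
  \sum_(m <- mpoly.msupp f)
     f@_m *: (A ^+ (m (ord0 : 'I_2)) *m B ^+ (m (ord_max : 'I_2))).

Definition origin (K : fieldType) : 'I_2 -> K := fun=> 0.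

Definition jacobian0 (K : fieldType) (f g : {mpoly K[2]}) : 'M[K]_2 :=
  \matrix_(i < 2, j < 2) ((if i == ord0 then f else g)^`M(j)).@[origin K].

(* This and poly_similar are meant for P in N(K). That is not imposed here, as
   subst_pair P0 Q is in N(K) for every Q when P0 is in N(K<X, Y>). *)
Definition poly_equivalent (K : fieldType) (P Q : mxpair K) : Prop :=
  exists f g : {mpoly K[2]},
    [/\ f.@[origin K] = 0, g.@[origin K] = 0, \det (jacobian0 f g) != 0
      & Q = MxPair (mpoly_mxeval f (mx1 P) (mx2 P))
                   (mpoly_mxeval g (mx1 P) (mx2 P))].

Definition poly_similar (K : fieldType) (P Q : mxpair K) : Prop :=
  exists P' : mxpair K,
    [/\ comm_nilp_pair P', poly_equivalent P P' & mxpair_similar P' Q].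

(* K<X, Y>, as the algebra of the free monoid of words on 'I_2; the letters 0
   and 1 stand for X and Y. *)
Definition free_alg2 (K : fieldType) : nzRingType :=
  malg (fmonom 'I_2) K.

(* p(M, N), a word being sent to the ordered product of its letters. *)
Definition free_alg2_mxeval (K : fieldType) (n : nat) (M N : 'M[K]_n)
    (p : free_alg2 K) : 'M[K]_n :=
  \sum_(w <- monalg.msupp p)
     monalg.mcoeff w p *: \prod_(i <- w : seq 'I_2) (if i == ord0 then M else N).

(* P0(M, N); the size of the block matrices is displayed as \sum_(i < m) n,
   i.e. m * n. *)
Definition subst_pair (K : fieldType) (P0 : mxpair (free_alg2 K))
    (Q : mxpair K) : mxpair K :=
  MxPair
    (\mxblock_(i < mxsize P0, j < mxsize P0)
       free_alg2_mxeval (mx1 Q) (mx2 Q) (mx1 P0 i j))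
    (\mxblock_(i < mxsize P0, j < mxsize P0)
       free_alg2_mxeval (mx1 Q) (mx2 Q) (mx2 P0 i j)).

(* Main.v *)
Require Import Defs.
From mathcomp Require Import all_boot all_order all_algebra.
From mathcomp Require Import finmap zify.
(* The notations of monalg would override those of mpoly. *)
From mathcomp.multinomials Require Import -(notations) monalg.
From mathcomp.multinomials Require Import mpoly.

Set Implicit Arguments.
Unset Strict Implicit.
Unset Printing Implicit Defensive.

Import GRing.Theory.
Local Open Scope ring_scope.

(** A pair of commuting matrices [(x, y)] with [x^2 = 0], [y^3 = 0], [x y^2 = 0]
is a module over [L = K[x, y]/(x^2, x y^2, y^3)].  The pair used here is an
[L]-module graded by the grid Z^2, with [x] of degree (1, 0) and [y] of degree
(0, 1), supported on eleven grid points; [E^k] stands for [k] blocks at a point: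
<<
   va1:E^2 -y-> va2:E^2 -y-> va3:E
     |x           |x
     v            v
   vb2:E^4 -y-> vb3:E^2         where  vb1:E^4 -y-> vb2,  vb1 -x-> vc3

   vc1:E^2 -y-> vc2:E^4 -y-> vc3:E^4
     |x           |x
     v            v
   vd2:E^2 -y-> vd3:E^2
>>
The four spaces [E^4] are identified with one space [H = U + U], [U = E^2], on
which the remaining arrows cut out four subspaces: [U + 0] (the image of [va1]
in [vb2]), [0 + U] (the kernel of [vb2 -> vb3]), the diagonal (the image of
[vc1] in [vc2]), and the kernel of [(u, v) |-> u T + v (1 - T)], which is
[vc2 -> vd3].  A linear automorphism of [H] that respects them is [g + g] with
[g] commuting with [T], so the quadruple encodes the operator [T].  A fifth
subspace, the kernel [E + 0] of [va2 -> va3] in [U], allows [T] to carry two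
independent matrices: for [T] with rows [(0, 1)] and [(X, Y)] acting on row
vectors, [g] must be [h + h] with [h] commuting with [X] and [Y].

It remains to see that polynomial equivalence cannot destroy this structure.
Give [x] the weight 7 and [y] the weight 5; the weights of the eleven points
are then pairwise distinct and lie in an interval of length 13, which accounts
for the three monomial relations, of weights 14, 15 and 17.  As [f(x, y)] is
similar to a matrix of square zero, the coefficient of [y] in [f] is zero, so
that [f(x, y)] and [g(x, y)] are nonzero multiples of [x] and [y] plus terms of
higher weight ([leading_mxeval]).  Hence the lowest weight component of any
intertwiner is a homogeneous intertwiner of the untwisted modules, up to scalars
([drop_part_intertwines]).  Homogeneous intertwiners of negative weight are zero
([lowering_eq0]), so the intertwiner respects the weight filtration, and its
component of weight 0 is an isomorphism of graded modules, whose block at the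
first summand of [vc2] conjugates one pair into the other
([corner_conjugates]). *)

(** * Matrices given by weighted arrows *)

(** The matrix is that of a labelled graph on [0, ..., m]: an arrow
[(s, t, c)] maps block [s] to block [t] by [c].  Matrices act on row vectors. *)
Definition arrow_mx (m : nat) (R : pzRingType) (l : seq (nat * nat * R)) :
    'M[R]_m.+1 :=
  \matrix_(i, j) \sum_(e <- l | e.1 == (val i, val j)) e.2.
Arguments arrow_mx m {R} l.

Definition arrows_in (m : nat) (R : Type) (l : seq (nat * nat * R)) : bool :=
  all (fun e => (e.1.1 <= m) && (e.1.2 <= m))%N l.

Lemma mul_arrow_mx (m : nat) (R : pzRingType) (l : seq (nat * nat * R))
    (T : 'M[R]_m.+1) (p : nat) (r : 'I_m.+1) :
    (p <= m)%N -> arrows_in m l ->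
  (arrow_mx m l *m T) (inord p) r
    = \sum_(e <- l | e.1.1 == p) e.2 * T (inord e.1.2) r.
Proof.
move=> lepm; rewrite mxE; under eq_bigr do rewrite mxE /= inordK //.
elim: l => [_|[[s t] c] l IHl /= /andP[/andP[_ letm] {}/IHl IHl]].
  by rewrite big_nil big1 // => j _; rewrite big_nil mul0r.
rewrite big_cons /= -IHl.
have [-> | ne_sp] := eqVneq s p => /=; last first.
  by apply: eq_bigr => j _; rewrite big_cons xpair_eqE (negPf ne_sp).
rewrite (bigD1 (inord t)) //= [in RHS](bigD1 (inord t)) //=.
rewrite big_cons xpair_eqE /= inordK // !eqxx /= mulrDl -addrA.
congr (_ + (_ + _)); apply: eq_bigr => j ne_jt.
rewrite big_cons xpair_eqE eqxx /= ifN //.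
by apply: contraNneq ne_jt => ->; rewrite inord_val.
Qed.

Lemma mul_mx_arrow (m : nat) (R : pzRingType) (l : seq (nat * nat * R))
    (T : 'M[R]_m.+1) (p : 'I_m.+1) (r : nat) :
    (r <= m)%N -> arrows_in m l ->
  (T *m arrow_mx m l) p (inord r)
    = \sum_(e <- l | e.1.2 == r) T p (inord e.1.1) * e.2.
Proof.
move=> lerm; rewrite mxE; under eq_bigr do rewrite mxE /= inordK //.
elim: l => [_|[[s t] c] l IHl /= /andP[/andP[lesm _] {}/IHl IHl]].
  by rewrite big_nil big1 // => j _; rewrite big_nil mulr0.
rewrite big_cons /= -IHl.
have [-> | ne_tr] := eqVneq t r => /=; last first.
  by apply: eq_bigr => j _; rewrite big_cons xpair_eqE (negPf ne_tr) andbF.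
rewrite (bigD1 (inord s)) //= [in RHS](bigD1 (inord s)) //=.
rewrite big_cons xpair_eqE /= inordK // !eqxx /= mulrDr -addrA.
congr (_ + (_ + _)); apply: eq_bigr => j ne_js.
rewrite big_cons xpair_eqE eqxx andbT /= ifN //.
by apply: contraNneq ne_js => ->; rewrite inord_val.
Qed.

Definition null_rows (m : nat) (R : pzRingType) (T : 'M[R]_m.+1) (s n : nat) :=
  forall i, (i < n)%N -> forall r, T (inord (s + i)) r = 0.

Section ScaledIntertwiner.
Variables (K : fieldType) (R : algType K) (m : nat) (c : K).
Variables (l l' : seq (nat * nat * R)) (T : 'M[R]_m.+1).
Hypothesis l_in : arrows_in m l.
Hypothesis l'_in : arrows_in m l'.
Hypothesis lT : forall p r,
  (arrow_mx m l *m T) p r = c *: (T *m arrow_mx m l') p r.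

Lemma arrow_row p r : (p <= m)%N ->
  \sum_(e <- l | e.1.1 == p) e.2 * T (inord e.1.2) r
    = c *: (T *m arrow_mx m l') (inord p) r.
Proof. by move=> lep; rewrite -lT mul_arrow_mx. Qed.

Lemma arrow_entry p r : (p <= m)%N -> (r <= m)%N ->
  \sum_(e <- l | e.1.1 == p) e.2 * T (inord e.1.2) (inord r)
    = c *: \sum_(e <- l' | e.1.2 == r) T (inord p) (inord e.1.1) * e.2.
Proof. by move=> lep ler; rewrite arrow_row // mul_mx_arrow. Qed.

(** Where an identity arrow [p -> s] is the only one out of [p], and an identity
arrow [q -> r] the only one into [r], the intertwining relation is a
proportionality between two entries of [T]. *)
Lemma arrow_transfer p s q r : (p <= m)%N -> (r <= m)%N ->
    [seq e <- l | e.1.1 == p] = [:: (p, s, 1)] ->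
    [seq e <- l' | e.1.2 == r] = [:: (q, r, 1)] ->
  T (inord s) (inord r) = c *: T (inord p) (inord q).
Proof.
move=> lep ler ps qr; have := arrow_entry lep ler.
by rewrite -big_filter ps big_seq1 -big_filter qr big_seq1 mul1r mulr1.
Qed.

Lemma null_rows_arrow s s' n : (s + n <= m.+1)%N ->
    (forall i, (i < n)%N -> [seq e <- l | e.1.1 == s + i]%N
                            = [:: ((s + i)%N, (s' + i)%N, 1)]) ->
  null_rows T s n -> null_rows T s' n.
Proof.
move=> le_s ss' Ts0 i lt_in r; have lep : (s + i <= m)%N by lia.
have := arrow_row r lep; rewrite -big_filter ss' // big_seq1 mul1r => ->.
by rewrite mxE big1 ?scaler0 // => q _; rewrite Ts0 // mul0r.
Qed.

End ScaledIntertwiner.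

(** * The graded module *)

Definition idarrows (R : pzRingType) (s t n : nat) :
    seq (nat * nat * R) :=
  [seq (e, 1) | e <- zip (iota s n) (iota t n)].
Arguments idarrows {R} s t n.

(* The first block at each grid point.  The numbering follows the weights. *)
Local Notation vc1 := 0%N.
Local Notation va1 := 2%N.
Local Notation vb1 := 4%N.
Local Notation vc2 := 8%N.
Local Notation va2 := 12%N.
Local Notation vd2 := 14%N.
Local Notation vb2 := 16%N.
Local Notation vc3 := 20%N.
Local Notation va3 := 24%N.
Local Notation vd3 := 25%N.
Local Notation vb3 := 27%N.

(** The weight of a grid point (i, j) is 7i + 5j, up to a constant chosen so
that [vc1] has weight 0. *)
Definition wt (i : nat) : nat :=
  nth 0%N (flatten [:: nseq 2 0; nseq 2 1; nseq 4 3; nseq 4 5; nseq 2 6;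
    nseq 2 7; nseq 4 8; nseq 4 10; nseq 1 11; nseq 2 12; nseq 2 13]) i.

(** The explicit arrows are the entries of the 4 x 2 matrix with upper half [T]
and lower half [1 - T], where [T] has rows [(0, 1)] and [(X, Y)]. *)
Definition xarrows (R : pzRingType) (X Y : R) : seq (nat * nat * R) :=
  idarrows va1 vb2 2 ++ idarrows va2 vb3 2 ++
  idarrows vb1 vc3 4 ++ idarrows vc1 vd2 2 ++
  [:: (vc2,              vd3.+1, 1);
      (vc2.+1, vd3, X);  (vc2.+1, vd3.+1, Y);
      (vc2.+2, vd3, 1);  (vc2.+2, vd3.+1, -1);
      (vc2.+3, vd3, -X); (vc2.+3, vd3.+1, 1 - Y)].
Arguments xarrows {R} X Y.

Definition yarrows (R : pzRingType) : seq (nat * nat * R) :=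
  idarrows va1 va2 2 ++ [:: (va2.+1, va3, 1)] ++
  idarrows vb1 vb2 4 ++ idarrows vb2 vb3 2 ++
  idarrows vc1 vc2 2 ++ idarrows vc1 vc2.+2 2 ++
  idarrows vc2 vc3 4 ++ idarrows vd2 vd3 2.
Arguments yarrows {R}.

Fact xarrows_in (R : pzRingType) (X Y : R) : arrows_in 28 (xarrows X Y).
Proof. by []. Qed.

Fact yarrows_in (R : pzRingType) : arrows_in 28 (@yarrows R).
Proof. by []. Qed.

Local Notation xmx X Y := (arrow_mx 28 (xarrows X Y)).
Local Notation ymx R := (arrow_mx 28 (@yarrows R)).

Definition raises (m : nat) (w : nat -> nat) (u : nat) (R : pzRingType)
    (A : 'M[R]_m) :=
  forall p q : 'I_m, w q != (w p + u)%N -> A p q = 0.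

Lemma arrow_mx_raises m w u (R : pzRingType) (l : seq (nat * nat * R)) :
  all (fun e => w e.1.2 == w e.1.1 + u)%N l -> raises w u (arrow_mx m l).
Proof.
move=> /allP l_u p q ne; rewrite mxE big_seq_cond big1 // => e /andP[/l_u].
by move=> + /eqP e_pq; rewrite e_pq /= (negPf ne).
Qed.

Lemma xmx_raises (R : pzRingType) (X Y : R) : raises wt 7 (xmx X Y).
Proof. exact: arrow_mx_raises. Qed.

Lemma ymx_raises (R : pzRingType) : raises wt 5 (ymx R).
Proof. exact: arrow_mx_raises. Qed.

Lemma raisesM m w u v (R : pzRingType) (A B : 'M[R]_m) :
  raises w u A -> raises w v B -> raises w (u + v) (A *m B).
Proof.
move=> hA hB p r ne; rewrite mxE big1 // => q _.
have [wq | nwq] := eqVneq (w q) (w p + u)%N; last by rewrite hA // mul0r.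
by rewrite hB ?mulr0 // wq -addnA.
Qed.

Lemma wt_le i : (wt i <= 13)%N.
Proof.
have [lt_i | ge_i] := ltnP i 29; last by rewrite /wt nth_default.
have /allP: all (fun i => wt i <= 13)%N (iota 0 29) by [].
by apply; rewrite mem_iota.
Qed.

Lemma raises_gt13_eq0 (R : pzRingType) (A : 'M[R]_29) (u : nat) :
  raises wt u A -> (13 < u)%N -> A = 0.
Proof.
move=> hA gt_u; apply/matrixP=> p q; rewrite mxE hA // neq_ltn.
by have := wt_le q; lia.
Qed.

(** Both products have weight 12, so their nonzero entries start at one of the
two lightest points [vc1] and [va1], where the squares commute: the path
[vc1 -> vc2 -> vd3] is [T + (1 - T)], and the other three paths that matter are
identities. *)
Lemma xmx_ymx_comm (R : pzRingType) (X Y : R) : comm_mx (xmx X Y) (ymx R).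
Proof.
apply/matrixP=> p r; rewrite -[p]inord_val -[r]inord_val.
have [eq_pr | ne_pr] := eqVneq (wt r) (wt p + 12)%N; last first.
  rewrite (raisesM (@xmx_raises _ X Y) (@ymx_raises R)) ?inord_val //.
  by rewrite (raisesM (@ymx_raises R) (@xmx_raises _ X Y)) ?inord_val.
rewrite !mul_arrow_mx ?leq_ord //.
have lep4 : (p < 4)%N.
  rewrite ltnNge; apply/negP => ge4.
  have /allP/(_ (p : nat)) : all (fun i => 1 < wt i)%N (iota 4 25) by [].
  rewrite mem_iota ge4 ltn_ord => /(_ isT).
  by have := wt_le r; lia.
pose ends i := if (i < 2)%N then [:: vd3; vd3.+1] else [:: vb3; vb3.+1].
have {eq_pr} : (r : nat) \in ends p.
  have /allP/(_ (p : nat)) : all (fun i => all (fun j =>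
      (wt j == wt i + 12) ==> (j \in ends i)) (iota 0 29))%N (iota 0 4) by [].
  rewrite mem_iota lep4 => /(_ isT) /allP/(_ (r : nat)).
  by rewrite mem_iota ltn_ord eq_pr eqxx => /(_ isT).
move: (p : nat) (r : nat) lep4; rewrite {}/ends => {}p {}r.
by case: p => [|[|[|[|]]]] //= _; rewrite !inE => /orP[] /eqP->;
  rewrite unlock /= !mxE /= ?inordK // unlock /=;
  rewrite ?(mulr0, mul1r, addr0, add0r) ?subrr // [RHS]addrC subrK.
Qed.

(** * Homogeneous intertwiners *)

Section Homogeneous.
Variables (K : fieldType) (R : algType K) (X1 Y1 X2 Y2 : R) (a b : K).
Variable T : 'M[R]_29.
Hypothesis a_neq0 : a != 0.
Hypothesis b_neq0 : b != 0.
Hypothesis xT : forall p r,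
  (xmx X1 Y1 *m T) p r = a *: (T *m xmx X2 Y2) p r.
Hypothesis yT : forall p r, (ymx R *m T) p r = b *: (T *m ymx R) p r.

Let t (p q : nat) : R := T (inord p) (inord q).

Lemma entry_x p r : (p <= 28)%N -> (r <= 28)%N ->
  \sum_(e <- xarrows X1 Y1 | e.1.1 == p) e.2 * t e.1.2 r
    = a *: \sum_(e <- xarrows X2 Y2 | e.1.2 == r) t p e.1.1 * e.2.
Proof. by apply: (arrow_entry (xarrows_in X1 Y1) (xarrows_in X2 Y2) xT). Qed.

Lemma entry_y p r : (p <= 28)%N -> (r <= 28)%N ->
  \sum_(e <- @yarrows R | e.1.1 == p) e.2 * t e.1.2 r
    = b *: \sum_(e <- @yarrows R | e.1.2 == r) t p e.1.1 * e.2.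
Proof. by apply: (arrow_entry (yarrows_in R) (yarrows_in R) yT). Qed.

Lemma transfer_x p s q r : (p <= 28)%N -> (r <= 28)%N ->
    [seq e <- xarrows X1 Y1 | e.1.1 == p] = [:: (p, s, 1)] ->
    [seq e <- xarrows X2 Y2 | e.1.2 == r] = [:: (q, r, 1)] ->
  t s r = a *: t p q.
Proof. by apply: (arrow_transfer (xarrows_in X1 Y1) (xarrows_in X2 Y2) xT). Qed.

Lemma transfer_y p s q r : (p <= 28)%N -> (r <= 28)%N ->
    [seq e <- @yarrows R | e.1.1 == p] = [:: (p, s, 1)] ->
    [seq e <- @yarrows R | e.1.2 == r] = [:: (q, r, 1)] ->
  t s r = b *: t p q.
Proof. by apply: (arrow_transfer (yarrows_in R) (yarrows_in R) yT). Qed.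

Let null_rows_x := null_rows_arrow (xarrows_in X1 Y1) (xarrows_in X2 Y2) xT.
Let null_rows_y := null_rows_arrow (yarrows_in R) (yarrows_in R) yT.

Section Lowering.
Variable d : nat.
Hypothesis d_gt0 : (0 < d)%N.
Hypothesis T_drop : forall p q : 'I_29, wt p != (wt q + d)%N -> T p q = 0.

(** The points lighter than [vc2] are [vc1], [va1] and [vb1], and [x] is
injective on their sum.  As [T] lowers weights, it maps block [p < 12] into that
sum, so it kills the block as soon as it kills its image under [x]. *)
Lemma null_row_x_inj p : (p < 12)%N ->
    (forall r, \sum_(e <- xarrows X1 Y1 | e.1.1 == p)
                 e.2 * T (inord e.1.2) r = 0) ->
  forall r, T (inord p) r = 0.
Proof.
move=> ltp xTp0 r; have lep : (p <= 28)%N by lia.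
have [lt_r8 | le8r] := ltnP r 8; last first.
  apply: T_drop; rewrite inordK //.
  have wt_r : (5 <= wt r)%N.
    have /allP := isT : all (fun r => 5 <= wt r)%N (iota 8 21).
    by apply; rewrite mem_iota; have := ltn_ord r; lia.
  have wt_p : (wt p <= 5)%N.
    have /allP := isT : all (fun r => wt r <= 5)%N (iota 0 12).
    by apply; rewrite mem_iota.
  by rewrite neq_ltn; apply/orP; left; lia.
have aT s : (s <= 28)%N ->
    \sum_(e <- xarrows X2 Y2 | e.1.2 == s) t p e.1.1 * e.2 = 0.
  move=> les; apply: (scalerI a_neq0); rewrite scaler0 -entry_x //.
  exact: xTp0.
(* The [r]-th entry of this list is the target of the arrow [x] out of [r], and
   no other arrow [x] ends there. *)
have := aT (nth 0 [:: 14; 15; 16; 17; 20; 21; 22; 23] r)%N.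
rewrite -[in T _ r](inord_val r) -/(t _ _).
move: (val r) lt_r8 => {}r.
do 8![case: r => [_ /(_ isT)|r]; first by rewrite unlock /= mulr1 addr0].
by [].
Qed.

Lemma null_rows_x_inj s s' n : (s + n <= 12)%N ->
    (forall i, (i < n)%N -> [seq e <- xarrows X1 Y1 | e.1.1 == s + i]%N
                            = [:: ((s + i)%N, (s' + i)%N, 1)]) ->
  null_rows T s' n -> null_rows T s n.
Proof.
move=> le_s ss' Ts'0 i lt_in; apply: null_row_x_inj => [|r]; first by lia.
by rewrite -big_filter ss' // big_seq1 mul1r Ts'0.
Qed.

(** The lightest point [vc1] is killed because nothing lies below it.  From
there, zeros propagate along the arrows, and backwards along [x] into [vc2],
[vb1] and [va1] by the injectivity above.  The generators of the module, at
[va1], [vb1], [vc1] and [vc2], are all reached. *)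
Lemma lowering_eq0 : T = 0.
Proof.
have Zc1 : null_rows T vc1 2.
  move=> i lt_i2 r; apply: T_drop; rewrite inordK; last lia.
  by case: i lt_i2 => [|[|]] // _; rewrite neq_ltn addn_gt0 d_gt0 orbT.
have Zd2 : null_rows T vd2 2.
  by apply: null_rows_x Zc1 => //; do 2![case=> //].
have Zd3 : null_rows T vd3 2.
  by apply: null_rows_y Zd2 => //; do 2![case=> //].
have Zc2 : null_rows T vc2 4.
  have [Z25 Z26] := (Zd3 0%N isT, Zd3 1%N isT).
  by do 4![case=> [_|]; first apply: null_row_x_inj => // r;
    first by rewrite unlock /= ?Z25 ?Z26 ?mulr0 ?addr0].
have Zc3 : null_rows T vc3 4.
  by apply: null_rows_y Zc2 => //; do 4![case=> //].
have Zb1 : null_rows T vb1 4.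
  by apply: null_rows_x_inj Zc3 => //; do 4![case=> //].
have Zb2 : null_rows T vb2 4.
  by apply: null_rows_y Zb1 => //; do 4![case=> //].
have Za1 : null_rows T va1 2.
  apply: (@null_rows_x_inj _ vb2) => //; first by do 2![case=> //].
  by move=> i lt_i2; apply: Zb2; lia.
have Za2 : null_rows T va2 2.
  by apply: null_rows_y Za1 => //; do 2![case=> //].
have Za3 : null_rows T va3 1.
  apply: (@null_rows_y va2.+1) => //; first by case.
  by case=> // _; apply: (Za2 1%N).
have Zb3 : null_rows T vb3 2.
  by apply: null_rows_x Za2 => //; do 2![case=> //].
have null s n p r : null_rows T s n -> (s <= p < s + n)%N -> T (inord p) r = 0.
  by move=> Zs lt_p; rewrite -[p](@subnKC s); [apply: Zs|]; lia.
apply/matrixP=> p r; rewrite mxE -[p]inord_val.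
have := ltn_ord p; move: (val p) => {}p ltp29.
have [lt2 | ge2] := ltnP p 2; first by apply: null Zc1 _; lia.
have [lt4 | ge4] := ltnP p 4; first by apply: null Za1 _; lia.
have [lt8 | ge8] := ltnP p 8; first by apply: null Zb1 _; lia.
have [lt12 | ge12] := ltnP p 12; first by apply: null Zc2 _; lia.
have [lt14 | ge14] := ltnP p 14; first by apply: null Za2 _; lia.
have [lt16 | ge16] := ltnP p 16; first by apply: null Zd2 _; lia.
have [lt20 | ge20] := ltnP p 20; first by apply: null Zb2 _; lia.
have [lt24 | ge24] := ltnP p 24; first by apply: null Zc3 _; lia.
have [lt25 | ge25] := ltnP p 25; first by apply: null Za3 _; lia.
have [lt27 | ge27] := ltnP p 27; first by apply: null Zd3 _; lia.
by apply: null Zb3 _; lia.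
Qed.

End Lowering.

(** The blocks of [T] at the four copies of [H] are proportional, along
[vb2 <- vb1 -> vc3 <- vc2]. *)
Lemma vc2_entry0 i j : (i < 4)%N -> (j < 4)%N ->
  t (vb2 + i) (vb2 + j) = 0 -> t (vc2 + i) (vc2 + j) = 0.
Proof.
move=> lt_i4 lt_j4 b2_0.
have I4 (P : nat -> Prop) : P 0%N -> P 1%N -> P 2%N -> P 3%N ->
    forall k, (k < 4)%N -> P k.
  by move=> P0 P1 P2 P3; do 4![case=> //].
have b12 : t (vb2 + i) (vb2 + j) = b *: t (vb1 + i) (vb1 + j).
  by apply: transfer_y; try lia;
    [move: (i) lt_i4 | move: (j) lt_j4]; apply: I4.
have b1c3 : t (vc3 + i) (vc3 + j) = a *: t (vb1 + i) (vb1 + j).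
  by apply: transfer_x; try lia;
    [move: (i) lt_i4 | move: (j) lt_j4]; apply: I4.
have c23 : t (vc3 + i) (vc3 + j) = b *: t (vc2 + i) (vc2 + j).
  by apply: transfer_y; try lia;
    [move: (i) lt_i4 | move: (j) lt_j4]; apply: I4.
apply: (scalerI b_neq0); rewrite scaler0 -c23 b1c3.
have -> : t (vb1 + i) (vb1 + j) = 0; last by rewrite scaler0.
by apply: (scalerI b_neq0); rewrite scaler0 -b12.
Qed.

(** On [H = U + U], the block of [T] at [vc2] is block diagonal because it
preserves [U + 0] and [0 + U]; write [g] for its upper left block.  The diagonal
of [H] and the arrow [vc2 -> vd3] show that [g] intertwines the two operators of [U], and
[g] is lower triangular because it preserves the kernel of [va2 -> va3]. *)
Lemma corner_conjugates :
  [/\ forall j, (0 < j < 4)%N -> t vc2 (vc2 + j) = 0,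
      X1 * t vc2 vc2 = t vc2 vc2 * X2 & Y1 * t vc2 vc2 = t vc2 vc2 * Y2].
Proof.
have P1 i j : (i < 2)%N -> (j < 2)%N -> t (vc2 + i) (vc2.+2 + j) = 0.
  move=> lt_i2 lt_j2; apply: (@vc2_entry0 i j.+2); [lia..|].
  have := @entry_x (va1 + i) (vb2 + j.+2).
  by case: i lt_i2 => [|[|]] // _; case: j lt_j2 => [|[|]] // _;
    move=> /(_ isT isT); rewrite unlock /= mul1r addr0 scaler0.
have P2 i j : (i < 2)%N -> (j < 2)%N -> t (vc2.+2 + i) (vc2 + j) = 0.
  move=> lt_i2 lt_j2; apply: (@vc2_entry0 i.+2 j); [lia..|].
  have := @entry_y (vb2.+2 + i) (vb3 + j).
  case: i lt_i2 => [|[|]] // _; case: j lt_j2 => [|[|]] // _;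
    move=> /(_ isT isT)/esym/eqP; rewrite unlock /= mulr1 addr0;
    by rewrite scaler_eq0 (negPf b_neq0) => /eqP.
(* Both sides are proportional to the block at [vc1], on the left through [vd2]
   and on the right through the diagonal of [H]. *)
have c2d3 i j : (i < 2)%N -> (j < 2)%N ->
    t (vd3 + i) (vd3 + j) = a *: t (vc2 + i) (vc2 + j).
  move=> lt_i2 lt_j2.
  have I2 (P : nat -> Prop) : P 0%N -> P 1%N -> forall k, (k < 2)%N -> P k.
    by move=> Q0 Q1; do 2![case=> //].
  have -> : t (vd3 + i) (vd3 + j) = b *: t (vd2 + i) (vd2 + j).
    apply: transfer_y; try lia;
      [by move: (i) lt_i2; apply: I2 | by move: (j) lt_j2; apply: I2].
  have -> : t (vd2 + i) (vd2 + j) = a *: t (vc1 + i) (vc1 + j).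
    apply: transfer_x; try lia;
      [by move: (i) lt_i2; apply: I2 | by move: (j) lt_j2; apply: I2].
  rewrite scalerA mulrC -scalerA; congr (_ *: _).
  have := P2 _ _ lt_i2 lt_j2; have := @entry_y i (vc2 + j).
  by case: i lt_i2 => [|[|]] // _; case: j lt_j2 => [|[|]] // _;
    move=> /(_ isT isT) + P2ij; rewrite unlock /= P2ij;
    rewrite !mul1r mulr1 !addr0.
have E01 : t vc2 vc2.+1 = 0.
  apply: (@vc2_entry0 0 1) => //.
  have -> : t vb2 vb2.+1 = a *: t va1 va1.+1 by exact: transfer_x.
  have -> : t va1 va1.+1 = 0; last by rewrite scaler0.
  apply: (scalerI b_neq0); rewrite scaler0.
  have <- : t va2 va2.+1 = b *: t va1 va1.+1 by exact: transfer_y.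
  apply: (scalerI b_neq0); rewrite scaler0.
  have := @entry_y va2 va3 isT isT.
  by rewrite unlock /= mulr1 addr0 => <-.
have P00 : t 8 10 = 0 by exact: (P1 0 0)%N.
have P01 : t 8 11 = 0 by exact: (P1 0 1)%N.
have P10 : t 9 10 = 0 by exact: (P1 1 0)%N.
have P11 : t 9 11 = 0 by exact: (P1 1 1)%N.
have d00 : t 25 25 = a *: t 8 8 by exact: (c2d3 0 0)%N.
have d01 : t 25 26 = a *: t 8 9 by exact: (c2d3 0 1)%N.
have d10 : t 26 25 = a *: t 9 8 by exact: (c2d3 1 0)%N.
have d11 : t 26 26 = a *: t 9 9 by exact: (c2d3 1 1)%N.
(* The four entries of [T1 * g = g * T2], for the two operators of [U]. *)
have aI := scalerI a_neq0.
have E10 : t 9 8 = 0.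
  apply: aI; rewrite scaler0 -d10; have := @entry_x 8 25 isT isT.
  by rewrite unlock /= E01 P00 P01 !mul0r mul1r !addr0 scaler0.
have E11 : t 9 9 = t 8 8.
  apply: aI; rewrite -d11; have := @entry_x 8 26 isT isT.
  by rewrite unlock /= E01 P00 P01 !mul0r mul1r mulr1 !addr0.
have EX := @entry_x 9 25 isT isT.
have EY := @entry_x 9 26 isT isT.
split; first by case=> [|[|[|[|]]]].
  apply: aI; move: EX; rewrite unlock /= d00 d10 E10 E11 P10 P11.
  by rewrite scaler0 mulr0 !mul0r !addr0 => <-; rewrite scalerAr.
apply: aI; move: EY; rewrite unlock /= d01 d11 E01 E10 E11 P10 P11.
by rewrite scaler0 mulr0 !mul0r !addr0 !add0r => <-; rewrite scalerAr.
Qed.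

End Homogeneous.

(** * Leading terms and the weight filtration *)

(** [a A] is the component of weight [u] of [A'], and the lower components of
[A'] vanish, when [A] is itself homogeneous of weight [u]. *)
Definition leading (m : nat) (K : fieldType) (R : algType K) (w : nat -> nat)
    (u : nat) (a : K) (A A' : 'M[R]_m) :=
  forall p q : 'I_m, (w q <= w p + u)%N -> A' p q = a *: A p q.

Lemma leadingM (m : nat) (K : fieldType) (R : algType K) (w : nat -> nat)
    (u v : nat) (a b : K) (A A' B B' : 'M[R]_m) :
    raises w u A -> raises w v B ->
    leading w u a A A' -> leading w v b B B' ->
  leading w (u + v) (a * b) (A *m B) (A' *m B').
Proof.
move=> hA hB lA lB p r le_r; rewrite !mxE scaler_sumr; apply: eq_bigr => q _.
have [lt_q | gt_q | eq_q] := ltngtP (w q) (w p + u)%N.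
- by rewrite lA 1?ltnW // !hA ?neq_ltn ?lt_q // scaler0 !mul0r scaler0.
- rewrite lB; last lia.
  by rewrite hA ?hB ?neq_ltn ?gt_q ?orbT ?mulr0 ?mul0r ?scaler0 ?mulr0 //; lia.
rewrite lA ?eq_q // lB; last lia.
by rewrite -scalerAl -scalerAr scalerA.
Qed.

Definition drop_part (m : nat) (R : pzRingType) (w : nat -> nat) (d : nat)
    (S : 'M[R]_m) : 'M[R]_m :=
  \matrix_(p, q) (if w p == (w q + d)%N then S p q else 0).

(** If [S] lowers weights by at most [d], the component of weight [u - d] of the
relation [A1' S = S A2'] involves only the leading components of [A1'] and
[A2'] and the component of [S] of weight [- d]. *)
Lemma drop_part_intertwines (m : nat) (K : fieldType) (R : algType K)
    (w : nat -> nat) (u d : nat) (a a' : K) (A1 A2 A1' A2' S : 'M[R]_m) :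
    a != 0 -> raises w u A1 -> raises w u A2 ->
    leading w u a A1 A1' -> leading w u a' A2 A2' ->
    (forall p q : 'I_m, (w q + d < w p)%N -> S p q = 0) ->
    A1' *m S = S *m A2' ->
  forall p r, (A1 *m drop_part w d S) p r
              = (a^-1 * a') *: (drop_part w d S *m A2) p r.
Proof.
move=> a_neq0 hA1 hA2 lA1 lA2 S0 /matrixP AS p r.
apply: (scalerI a_neq0); rewrite scalerA mulVKf //.
rewrite !mxE !scaler_sumr.
have [wpr | nwpr] := eqVneq (w p + u)%N (w r + d)%N; last first.
  rewrite !big1 // => q _; rewrite mxE.
    have [wq | nwq] := eqVneq (w p) (w q + d)%N; last by rewrite mul0r scaler0.
    rewrite hA2 ?mulr0 ?scaler0 //; apply: contraNneq nwpr => ->; lia.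
  have [wq | nwq] := eqVneq (w q) (w r + d)%N; last by rewrite mulr0 scaler0.
  by rewrite hA1 ?mul0r ?scaler0 //; apply: contraNneq nwpr; lia.
have := AS p r; rewrite !mxE => ASpr.
transitivity (\sum_j A1' p j * S j r); last rewrite {}ASpr; last symmetry.
  apply: eq_bigr => q _; rewrite mxE scalerAl.
  have [lt_q | gt_q | eq_q] := ltngtP (w q) (w p + u)%N.
  - by rewrite lA1 1?ltnW // hA1 ?scaler0 ?mul0r // ltn_eqF.
  - rewrite S0 ?mulr0; last by lia.
    by rewrite ifN ?mulr0 //; lia.
  - by rewrite lA1 ?eq_q // wpr eqxx.
apply: eq_bigr => q _; rewrite mxE scalerAr.
have [lt_q | gt_q | eq_q] := ltngtP (w r) (w q + u)%N.
- by rewrite lA2 1?ltnW // hA2 ?scaler0 ?mulr0 // ltn_eqF.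
- rewrite S0 ?mul0r; last by lia.
  by rewrite ifN ?mul0r //; lia.
- rewrite lA2 ?eq_q //; case: eqVneq => //; lia.
Qed.

Lemma intertwiner_filtered (K : fieldType) (R : algType K)
    (X1 Y1 X2 Y2 : R) (a a' b b' : K) (A1 B1 A2 B2 S : 'M[R]_29) :
    a != 0 -> a' != 0 -> b != 0 -> b' != 0 ->
    leading wt 7 a (xmx X1 Y1) A1 -> leading wt 5 b (ymx R) B1 ->
    leading wt 7 a' (xmx X2 Y2) A2 -> leading wt 5 b' (ymx R) B2 ->
    A1 *m S = S *m A2 -> B1 *m S = S *m B2 ->
  forall p q : 'I_29, (wt q < wt p)%N -> S p q = 0.
Proof.
move=> a_neq0 a'_neq0 b_neq0 b'_neq0 lA1 lB1 lA2 lB2 AS BS.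
(* Descending induction on the largest possible drop [14 - k] of weight. *)
suff S0 k : (k <= 14)%N ->
    forall p q : 'I_29, (wt q + (14 - k) < wt p)%N -> S p q = 0.
  by move=> p q lt_qp; apply: (S0 14%N) => //; rewrite subnn addn0.
elim: k => [_ p q|k IHk lt_k p q lt_qp].
  by have := wt_le p; lia.
have {}IHk := IHk (ltnW lt_k).
have [lt_kqp | ge_kqp] := ltnP (wt q + (14 - k))%N (wt p); first exact: IHk.
have eq_qp : wt p = (wt q + (14 - k))%N by lia.
have hA := drop_part_intertwines a_neq0 (xmx_raises X1 Y1) (xmx_raises X2 Y2)
  lA1 lA2 IHk AS.
have hB := drop_part_intertwines b_neq0 (ymx_raises R) (ymx_raises R)
  lB1 lB2 IHk BS.
have /matrixP/(_ p q) : drop_part wt (14 - k) S = 0; last first.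
  by rewrite !mxE eq_qp eqxx.
have d_gt0 : (0 < 14 - k)%N by lia.
apply: (lowering_eq0 _ _ hA hB d_gt0); rewrite ?mulf_neq0 ?invr_neq0 //.
by move=> p' q' ne; rewrite mxE (negPf ne).
Qed.

(** In the row of the first block at [vc2], the entries at lighter blocks vanish
by the filtration, and those at the other blocks of [vc2] because the degree 0
part of [S] satisfies [corner_conjugates]. *)
Lemma intertwiner_corner (K : fieldType) (R : algType K)
    (X1 Y1 X2 Y2 : R) (a a' b b' : K) (A1 B1 A2 B2 S : 'M[R]_29) :
    a != 0 -> a' != 0 -> b != 0 -> b' != 0 ->
    leading wt 7 a (xmx X1 Y1) A1 -> leading wt 5 b (ymx R) B1 ->
    leading wt 7 a' (xmx X2 Y2) A2 -> leading wt 5 b' (ymx R) B2 ->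
    A1 *m S = S *m A2 -> B1 *m S = S *m B2 ->
  let g := S (inord vc2) (inord vc2) in
  [/\ forall q : 'I_29, q != vc2 :> nat -> (wt q <= wt vc2)%N ->
        S (inord vc2) q = 0,
      X1 * g = g * X2 & Y1 * g = g * Y2].
Proof.
move=> a_neq0 a'_neq0 b_neq0 b'_neq0 lA1 lB1 lA2 lB2 AS BS g.
have S0 := intertwiner_filtered a_neq0 a'_neq0 b_neq0 b'_neq0
  lA1 lB1 lA2 lB2 AS BS.
have S0' (p q : 'I_29) : (wt q + 0 < wt p)%N -> S p q = 0.
  by rewrite addn0; apply: S0.
have hA := drop_part_intertwines a_neq0 (xmx_raises X1 Y1) (xmx_raises X2 Y2)
  lA1 lA2 S0' AS.
have hB := drop_part_intertwines b_neq0 (ymx_raises R) (ymx_raises R)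
  lB1 lB2 S0' BS.
have [||offdiag] := corner_conjugates _ _ hA hB;
  rewrite ?mulf_neq0 ?invr_neq0 //.
rewrite !mxE addn0 eqxx => gX gY; split=> // q ne_q.
rewrite leq_eqVlt => /predU1P[eq_q | lt_q]; last by rewrite S0 // inordK.
have q_in : (8 <= q < 12)%N.
  have /allP/(_ (val q)) : all (fun i => (wt i == wt vc2) ==> (8 <= i < 12))%N
    (iota 0 29) by [].
  by rewrite mem_iota ltn_ord eq_q eqxx => /(_ isT).
have := offdiag (q - 8)%N; rewrite subnKC; last by lia.
rewrite mxE inord_val inordK // eq_q addn0 eqxx; apply; lia.
Qed.

(** An intertwiner and its inverse both respect the weight filtration, so their
product at the corner of [vc2] reduces to the product of the two corners: the
other summands vanish at lighter blocks for [S], at heavier blocks for [S'],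
and within [vc2] because the degree 0 part of [S] is diagonal there. *)
Lemma intertwiner_similar (K : fieldType) (R : algType K)
    (X1 Y1 X2 Y2 : R) (a b : K) (A B S S' : 'M[R]_29) :
    a != 0 -> b != 0 ->
    leading wt 7 a (xmx X1 Y1) A -> leading wt 5 b (ymx R) B ->
    A *m S = S *m xmx X2 Y2 -> B *m S = S *m ymx R ->
    S *m S' = 1%:M -> S' *m S = 1%:M ->
  exists g g' : R, [/\ g * g' = 1, X1 * g = g * X2 & Y1 * g = g * Y2].
Proof.
move=> a_neq0 b_neq0 lA lB AS BS SS' S'S.
have l1 (C : 'M[R]_29) u : leading wt u (1 : K) C C.
  by move=> p q _; rewrite scale1r.
have n1 : (1 : K) != 0 := oner_neq0 K.
have [offdiag gX gY] := intertwiner_corner a_neq0 n1 b_neq0 n1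
  lA lB (l1 _ _) (l1 _ _) AS BS.
exists (S (inord vc2) (inord vc2)), (S' (inord vc2) (inord vc2)); split=> //.
have AS' : xmx X2 Y2 *m S' = S' *m A.
  by rewrite -[LHS]mul1mx -S'S -mulmxA (mulmxA S) -AS -mulmxA SS' mulmx1.
have BS' : ymx R *m S' = S' *m B.
  by rewrite -[LHS]mul1mx -S'S -mulmxA (mulmxA S) -BS -mulmxA SS' mulmx1.
have S'0 := intertwiner_filtered n1 a_neq0 n1 b_neq0
  (l1 _ _) (l1 _ _) lA lB AS' BS'.
have /matrixP/(_ (inord vc2) (inord vc2)) := SS'.
rewrite !mxE eqxx mulr1n => <-; rewrite (bigD1 (inord vc2)) //= big1 ?addr0 //.
move=> q ne_q; have [le_q | lt_q] := leqP (wt q) (wt vc2).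
  rewrite offdiag ?mul0r //; apply: contraNneq ne_q => eq_q.
  by apply/eqP/val_inj; rewrite /= inordK.
by rewrite S'0 ?mulr0 // inordK.
Qed.

(** * Block matrices and polynomial evaluation *)

(** Matrices of blocks are viewed as matrices over the ring of blocks, which is
nontrivial only for blocks of nonzero size; hence the sizes [n.+1] below. *)
Definition blocks (K : fieldType) (m n : nat) (M : 'M[K]_(\sum_(i < m) n)) :
    'M['M[K]_n]_m :=
  \matrix_(i, j) submxblock M i j.

Lemma blocks_mxblock (K : fieldType) (m n : nat) (F : 'I_m -> 'I_m -> 'M[K]_n) :
  blocks (\mxblock_(i, j) F i j) = \matrix_(i, j) F i j.
Proof. by apply/matrixP=> i j; rewrite !mxE mxblockK. Qed.

Lemma blocksM (K : fieldType) (m n : nat) (A B : 'M[K]_(\sum_(i < m) n.+1)) :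
  blocks (A *m B) = blocks A *m blocks B.
Proof.
rewrite -[A]submxblockK -[B]submxblockK mul_mxblock !blocks_mxblock.
by apply/matrixP=> i j; rewrite !mxE; apply: eq_bigr => k _; rewrite !mxE.
Qed.

Lemma blocks1 (K : fieldType) (m n : nat) :
  blocks (1%:M : 'M[K]_(\sum_(i < m) n.+1)) = 1%:M.
Proof.
apply/matrixP=> i j; rewrite !mxE; have [<- | ne_ij] := eqVneq i j.
  by apply/matrixP=> k l; rewrite !mxE -val_eqE tagnat.eq_Rank eqxx.
apply/matrixP=> k l; rewrite !mxE -val_eqE tagnat.eq_Rank (negPf ne_ij).
by rewrite mulr0n.
Qed.

Lemma blocksD (K : fieldType) (m n : nat) (A B : 'M[K]_(\sum_(i < m) n)) :
  blocks (A + B) = blocks A + blocks B.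
Proof. by apply/matrixP=> i j; rewrite !mxE submxblockD. Qed.

Lemma blocks0 (K : fieldType) (m n : nat) :
  blocks (0 : 'M[K]_(\sum_(i < m) n)) = 0.
Proof. by apply/matrixP=> i j; rewrite !mxE submxblock0. Qed.

Lemma blocksZ (K : fieldType) (m n : nat) (c : K)
    (A : 'M[K]_(\sum_(i < m) n)) (i j : 'I_m) :
  blocks (c *: A) i j = c *: blocks A i j.
Proof. by rewrite !mxE; apply/matrixP=> k l; rewrite !mxE. Qed.

Lemma raises_blocksX (K : fieldType) (w : nat -> nat) (m n u k : nat)
    (A : 'M[K]_(\sum_(i < m) n.+1)) :
  raises w u (blocks A) -> raises w (k * u) (blocks (A ^+ k)).
Proof.
move=> hA; elim: k => [|k IHk].
  rewrite expr0 blocks1 => p q ne; rewrite mxE.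
  by rewrite (negPf (contraNneq _ ne)) ?mulr0n // => ->; rewrite addn0.
by rewrite exprS mulSn -mulmxE blocksM; apply: raisesM.
Qed.

(** When the monomial [k] has the smallest weight among those of [f], only the
term of [k] contributes to the leading component of [f(A, B)]. *)
Lemma leading_mxeval (K : fieldType) (w : nat -> nat) (m n u v s : nat)
    (A B : 'M[K]_(\sum_(i < m) n.+1)) (f : {mpoly K[2]}) (k : 'X_{1..2}) :
    raises w u (blocks A) -> raises w v (blocks B) ->
    (forall k' : 'X_{1..2}, k' != k -> f@_k' != 0 ->
       (s < k' ord0 * u + k' ord_max * v)%N) ->
  leading w s f@_k (blocks (A ^+ (k ord0) *m B ^+ (k ord_max)))
    (blocks (mpoly_mxeval f A B)).
Proof.
move=> hA hB f_s p q le_q.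
have monE (k' : 'X_{1..2}) : raises w (k' ord0 * u + k' ord_max * v)
    (blocks (A ^+ (k' ord0) *m B ^+ (k' ord_max))).
  by rewrite blocksM; apply: raisesM; apply: raises_blocksX.
rewrite (big_morph _ (@blocksD K m n.+1) (blocks0 _ _ _)) summxE.
under eq_bigr do rewrite blocksZ.
have mon0 k' : k' != k ->
    f@_k' *: blocks (A ^+ (k' ord0) *m B ^+ (k' ord_max)) p q = 0.
  move=> ne_k; have [-> | fk'] := eqVneq f@_k' 0; first by rewrite scale0r.
  rewrite (monE k') ?scaler0 // neq_ltn (leq_ltn_trans le_q) //.
  by rewrite ltn_add2l f_s.
have [k_in | k_notin] := boolP (k \in mpoly.msupp f).
  by rewrite (bigD1_seq k) //= -[RHS]addr0; congr (_ + _); exact: big1.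
rewrite (memN_msupp_eq0 k_notin) scale0r; apply: big1_seq => k' /andP[_ k'_in].
by apply: mon0; apply: contraNneq k_notin => <-.
Qed.

Lemma meval_origin (K : fieldType) (f : {mpoly K[2]}) :
  f.@[@origin K] = f@_0.
Proof.
rewrite mevalE [in RHS](mpolyE f) raddf_sum /=; apply: eq_bigr => k _.
rewrite mcoeffZ mcoeffX; congr (_ * _).
rewrite big_ord_recl big_ord1 /origin !expr0n -natrM mulnb.
congr (_ %:R); congr (nat_of_bool _).
apply/andP/eqP => [[/eqP k0 /eqP k1] | ->]; last by rewrite !mnmE.
by apply/mnmP=> i; rewrite mnmE; case: i => [[|[|]] // lt_i];
  [rewrite -[RHS]k0 | rewrite -[RHS]k1]; congr (k _); apply: val_inj.
Qed.

Lemma mderiv_origin (K : fieldType) (f : {mpoly K[2]}) (i : 'I_2) :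
  (f^`M(i)).@[@origin K] = f@_U_(i).
Proof.
by rewrite meval_origin mcoeff_deriv mnmE mulr1n add0m.
Qed.

(** * Substitution in the free algebra *)

Definition letter (K : fieldType) (i : 'I_2) : free_alg2 K :=
  mkmalgU (FMonom [:: i]) 1.

Lemma free_alg2_mxevalE (K : fieldType) (n : nat) (M N : 'M[K]_n.+1)
    (p : free_alg2 K) :
  free_alg2_mxeval M N p
    = monalg.mmap (in_alg 'M[K]_n.+1)
        (fun w : fmonom 'I_2 =>
           \prod_(i <- w : seq 'I_2) (if i == ord0 then M else N)) p.
Proof.
by rewrite monalg.mmapE; apply: eq_bigr => w _; rewrite mulr_algl.
Qed.

Section Eval.
Variables (K : fieldType) (n : nat) (M N : 'M[K]_n.+1).
Let ev : free_alg2 K -> 'M[K]_n.+1 := free_alg2_mxeval M N.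

Lemma mxevalD : {morph ev : p q / p + q}.
Proof. by move=> p q; rewrite /ev !free_alg2_mxevalE monalg.mmapD. Qed.

Lemma mxevalN : {morph ev : p / - p}.
Proof. by move=> p; rewrite /ev !free_alg2_mxevalE monalg.mmapN. Qed.

Lemma mxeval0 : ev 0 = 0.
Proof. by rewrite /ev !free_alg2_mxevalE monalg.mmap0. Qed.

Lemma mxeval1 : ev 1 = 1.
Proof.
by rewrite /ev !free_alg2_mxevalE monalg.mmapU /= scale1r fm1 big_nil mul1r.
Qed.

Lemma mxeval_letter i : ev (letter K i) = if i == ord0 then M else N.
Proof.
by rewrite /ev !free_alg2_mxevalE monalg.mmapU /= scale1r big_seq1 mul1r.
Qed.

End Eval.

Lemma mxeval_arrow_mx (K : fieldType) (m n : nat) (M N : 'M[K]_n.+1)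
    (l : seq (nat * nat * free_alg2 K)) (i j : 'I_m.+1) :
  free_alg2_mxeval M N (arrow_mx m l i j)
    = arrow_mx m [seq (e.1, free_alg2_mxeval M N e.2) | e <- l] i j.
Proof.
by rewrite !mxE big_map (big_morph _ (mxevalD M N) (mxeval0 M N)).
Qed.

Definition wild_pair (R : pzRingType) (X Y : R) : mxpair R :=
  MxPair (xmx X Y) (ymx R).

Lemma map_xarrows (R S : pzRingType) (f : R -> S) (X Y : R) :
    f 1 = 1 -> {morph f : x y / x + y} -> {morph f : x / - x} ->
  [seq (e.1, f e.2) | e <- xarrows X Y] = xarrows (f X) (f Y).
Proof. by move=> f1 fD fN; rewrite /= !(fD, fN, f1). Qed.

Lemma map_yarrows (R S : pzRingType) (f : R -> S) :
  f 1 = 1 -> [seq (e.1, f e.2) | e <- @yarrows R] = yarrows.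
Proof. by move=> f1; rewrite /= !f1. Qed.

Lemma mxeval_xmx (K : fieldType) (n : nat) (M N : 'M[K]_n.+1)
    (X Y : free_alg2 K) i j :
    free_alg2_mxeval M N X = M -> free_alg2_mxeval M N Y = N ->
  free_alg2_mxeval M N (xmx X Y i j) = xmx M N i j.
Proof.
move=> evX evY; rewrite mxeval_arrow_mx.
rewrite (map_xarrows _ _ (mxeval1 M N) (mxevalD M N) (mxevalN M N)).
by rewrite evX evY.
Qed.

Lemma mxeval_ymx (K : fieldType) (n : nat) (M N : 'M[K]_n.+1) i j :
  free_alg2_mxeval M N (ymx (free_alg2 K) i j) = ymx _ i j.
Proof. by rewrite mxeval_arrow_mx (map_yarrows (mxeval1 M N)). Qed.

(** * Recovering a pair of matrices *)

Lemma MxPair_inj (R : Type) (s : nat) (A B A' B' : 'M[R]_s) :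
  MxPair A B = MxPair A' B' -> A = A' /\ B = B'.
Proof.
have inj := Eqdep_dec.inj_pair2_eq_dec _ (@eq_comparable nat)
  (fun k => 'M[R]_k).
by case=> /inj-> /inj->.
Qed.

Lemma similar_MxPair (K : fieldType) (s : nat) (A B A' B' : 'M[K]_s) :
    mxpair_similar (MxPair A B) (MxPair A' B') <->
  exists S : 'M[K]_s, [/\ S \in unitmx, A *m S = S *m A' & B *m S = S *m B'].
Proof.
split=> [[n [A0 [B0 [S [uS eqP eqQ]]]]] | [S [uS AS BS]]].
  have en : s = n by case: eqP.
  move: A B A' B' eqP eqQ; rewrite {s}en => A B A' B'.
  move=> /MxPair_inj[-> ->] /MxPair_inj[-> ->]; exists S.
  by rewrite !mulmxA mulmxV // !mul1mx.
exists s, A, B, S; split=> //.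
by rewrite -!mulmxA AS BS !mulmxA mulVmx // !mul1mx.
Qed.

Lemma mnm2_eq (k l : 'X_{1..2}) :
  k ord0 = l ord0 -> k ord_max = l ord_max -> k = l.
Proof.
move=> eq0 eq1; apply/mnmP=> i; case: i => [[|[|]] // lt_i].
  by have -> : Ordinal lt_i = ord0 by apply: val_inj.
by have -> : Ordinal lt_i = ord_max by apply: val_inj.
Qed.

(** As [f(A1, B1)] is similar to [A2], its square is zero; the component of
weight 10 of that square is [y^2] times the square of the coefficient of [y] in [f],
and [y^2] is nonzero on [vb1].  So that coefficient vanishes, and the
Jacobian condition makes the coefficient of [x] in [f] and that of [y] in [g]
nonzero. *)
Lemma mxpair_recovered (K : fieldType) (n : nat) (M1 N1 M2 N2 : 'M[K]_n.+1)
    (A1 B1 A2 B2 S : 'M[K]_(\sum_(i < 29) n.+1)) (f g : {mpoly K[2]}) :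
    blocks A1 = xmx M1 N1 -> blocks B1 = ymx _ ->
    blocks A2 = xmx M2 N2 -> blocks B2 = ymx _ ->
    f.@[@origin K] = 0 -> g.@[@origin K] = 0 -> \det (jacobian0 f g) != 0 ->
    S \in unitmx ->
    mpoly_mxeval f A1 B1 *m S = S *m A2 ->
    mpoly_mxeval g A1 B1 *m S = S *m B2 ->
  mxpair_similar (MxPair M1 N1) (MxPair M2 N2).
Proof.
move=> bA1 bB1 bA2 bB2; rewrite !meval_origin => f0 g0 J_neq0 uS.
move=> /(congr1 (@blocks _ _ _)) AS /(congr1 (@blocks _ _ _)) BS.
rewrite !blocksM bA2 in AS; rewrite !blocksM bB2 in BS.
have SS' : blocks S *m blocks (invmx S) = 1%:M.
  by rewrite -blocksM mulmxV // blocks1.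
have S'S : blocks (invmx S) *m blocks S = 1%:M.
  by rewrite -blocksM mulVmx // blocks1.
have hA : raises wt 7 (blocks A1) by rewrite bA1; apply: xmx_raises.
have hB : raises wt 5 (blocks B1) by rewrite bB1; apply: ymx_raises.
have neq0 (h : {mpoly K[2]}) (k : 'X_{1..2}) :
    h@_0 = 0 -> h@_k != 0 -> (0 < k ord0 + k ord_max)%N.
  move=> h0; apply: contraNT.
  rewrite -eqn0Ngt addn_eq0 => /andP[/eqP k0 /eqP k1].
  by rewrite (@mnm2_eq k 0%MM) ?h0 // mnmE.
have lead_y h : h@_0 = 0 ->
    leading wt 5 h@_U_(ord_max) (ymx _) (blocks (mpoly_mxeval h A1 B1)).
  move=> h0; have := @leading_mxeval _ _ _ _ _ _ 5 _ _ h U_(ord_max) hA hB.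
  rewrite !mnm1E /= expr0 expr1 mulmxE mul1r bB1; apply=> k ne_k.
  move=> /(neq0 _ _ h0).
  have [k_eq | ] := eqVneq (k ord0 * 7 + k ord_max * 5)%N 5%N; last lia.
  case/eqP: ne_k; apply: mnm2_eq; rewrite mnm1E /=; lia.
have fy0 : f@_U_(ord_max) = 0.
  have sq0 : blocks (mpoly_mxeval f A1 B1) *m blocks (mpoly_mxeval f A1 B1) = 0.
    rewrite -[LHS]mulmx1 -SS' -!mulmxA (mulmxA _ (blocks S)) AS !mulmxA AS.
    have AA0 : xmx M2 N2 *m xmx M2 N2 = 0.
      have hx := @xmx_raises _ M2 N2.
      exact: raises_gt13_eq0 (raisesM hx hx) _.
    by rewrite -(mulmxA (blocks S)) AA0 mulmx0 mul0mx.
  have := leadingM (@ymx_raises _) (@ymx_raises _) (lead_y _ f0) (lead_y _ f0).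
  move=> /(_ (inord vb1) (inord vb3)); rewrite sq0 !inordK // => /(_ isT).
  rewrite mul_arrow_mx // unlock /= !mxE /= ?inordK // unlock /= mul1r !addr0.
  by move/esym/eqP; rewrite scaler_eq0 oner_eq0 orbF mulf_eq0 orbb => /eqP.
have lead_x : leading wt 7 f@_U_(ord0) (xmx M1 N1)
    (blocks (mpoly_mxeval f A1 B1)).
  have := @leading_mxeval _ _ _ _ _ _ 7 _ _ f U_(ord0) hA hB.
  rewrite !mnm1E /= expr0 expr1 mulmxE mulr1 bA1; apply=> k ne_k fk.
  have k_gt0 := neq0 _ _ f0 fk.
  have ne_y : k != U_(ord_max)%MM by apply: contraNneq fk => ->; rewrite fy0.
  have [k_le | ] := leqP (k ord0 * 7 + k ord_max * 5)%N 7%N; last lia.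
  have [k0 | k0] := eqVneq (k ord0) 0%N.
    by case/eqP: ne_y; apply: mnm2_eq; rewrite mnm1E /=; lia.
  by case/eqP: ne_k; apply: mnm2_eq; rewrite mnm1E /=; lia.
have [fx_neq0 gy_neq0] : f@_U_(ord0) != 0 /\ g@_U_(ord_max) != 0.
  apply/andP; rewrite -negb_or -mulf_eq0; apply: contraNneq J_neq0 => fg0.
  rewrite det_trig; last first.
    apply/is_trig_mxP=> i j lt_ij; have lt_j2 := ltn_ord j.
    have -> : i = ord0 by apply: val_inj => /=; lia.
    have -> : j = ord_max by apply: val_inj => /=; lia.
    by rewrite mxE mderiv_origin.
  rewrite big_ord_recl big_ord1 !mxE !mderiv_origin /=.
  by rewrite (_ : lift ord0 ord0 = ord_max) ?fg0 //; apply: val_inj.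
have [h [h' [hh' Xh Yh]]] :=
  intertwiner_similar fx_neq0 gy_neq0 lead_x (lead_y _ g0) AS BS SS' S'S.
apply/similar_MxPair; exists h; split=> //.
by case: (mulmx1_unit hh').
Qed.

Unset Implicit Arguments.

Theorem mainTheorem1 (K : fieldType) :
  exists P0 : mxpair (free_alg2 K),
    [/\ comm_nilp_pair P0,
        mx1 P0 ^+ 2 = 0,
        mx2 P0 ^+ 3 = 0,
        mx1 P0 *m mx2 P0 ^+ 2 = 0
      & forall Q1 Q2 : mxpair K,
          poly_similar (subst_pair P0 Q1) (subst_pair P0 Q2) ->
          mxpair_similar Q1 Q2].
Proof.
have X0 := @xmx_raises (free_alg2 K) (letter K ord0) (letter K ord_max).
have Y0 := @ymx_raises (free_alg2 K).
have A2 : xmx (letter K ord0) (letter K ord_max) ^+ 2 = 0.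
  exact: raises_gt13_eq0 (raisesM X0 X0) _.
have B3 : ymx (free_alg2 K) ^+ 3 = 0.
  exact: raises_gt13_eq0 (raisesM Y0 (raisesM Y0 Y0)) _.
exists (wild_pair (letter K ord0) (letter K ord_max)).
split; [split | exact: A2 | exact: B3 | | ].
- exact: xmx_ymx_comm.
- by exists 2%N; exact: A2.
- by exists 3%N; exact: B3.
- exact: raises_gt13_eq0 (raisesM X0 (raisesM Y0 Y0)) _.
move=> [n1 M1 N1] [n2 M2 N2] [P' [_ [f [g [f0 g0 J_neq0 defP']]] simP']].
have eq_n : n1 = n2.
  case: simP' defP' => n [A [B [S [_ -> eqQ]]]] eqP'.
  have /eqP := congr1 (@mxsize K) eqP'.
  rewrite -[mxsize (MxPair A B)](congr1 (@mxsize K) eqQ).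
  by rewrite /= !sum_nat_const card_ord eqn_mul2l => /eqP.
case: n2 / eq_n M2 N2 simP' => M2 N2; rewrite {P'}defP'.
(* Empty matrices are always similar; from here on the blocks form an algebra
   with [1 != 0]. *)
case: n1 M1 N1 M2 N2 => [|n] M1 N1 M2 N2 /similar_MxPair[S [uS AS BS]].
  apply/similar_MxPair; exists 1%:M; rewrite unitmx1.
  by split=> //; apply/matrixP=> -[].
have bA (M N : 'M[K]_n.+1) : blocks (\mxblock_(i < 29, j < 29)
    free_alg2_mxeval M N (xmx (letter K ord0) (letter K ord_max) i j))
      = xmx M N.
  rewrite blocks_mxblock; apply/matrixP=> i j; rewrite mxE mxeval_xmx //;
  exact: mxeval_letter.
have bB (M N : 'M[K]_n.+1) : blocks (\mxblock_(i < 29, j < 29)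
    free_alg2_mxeval M N (ymx (free_alg2 K) i j)) = ymx _.
  by rewrite blocks_mxblock; apply/matrixP=> i j; rewrite mxE mxeval_ymx.
exact: mxpair_recovered (bA M1 N1) (bB M1 N1) (bA M2 N2) (bB M2 N2)
  f0 g0 J_neq0 uS AS BS.
Qed.
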